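(* Let $E$ and $F$ be Banach spaces over the same field $\mathbb{K}$, where $\mathbb{K}=\mathbb{R}$ or $\mathbb{K}=\mathbb{C}$, and let $m,n$ be positive integers. For each $A\in\mathcal{L}_a^s(^{mn}E;F)$ let $\Psi A\in\mathcal{P}_a^s(^{n,\overset{m}{\ldots},n}E;F)$ be defined by $$\Psi A(x_1,\ldots,x_m)=Ax_1^n\cdots x_m^n:=A(\underbrace{x_1,\ldots,x_1}_{n},\ldots,\underbrace{x_m,\ldots,x_m}_{n})$$ for every $x_1,\ldots,x_m\in E$. Then $\Psi$ is a linear isomorphism from $\mathcal{L}_a^s(^{mn}E;F)$ onto its range $\operatorname{Im}\Psi$. Moreover, for each $P\in\mathcal{P}_a^s(^{n,\overset{m}{\ldots},n}E;F)$ the following conditions are equivalent: (a) $P\in\operatorname{Im}\Psi$; (b) for all $x_0,x_1,\ldots,x_m\in E$, $$P(x_1,\ldots,x_m)=\frac{1}{(mn)!\,2^{mn}}\sum_{\varepsilon_1,\ldots,\varepsilon_{mn}=\pm1}\varepsilon_1\cdots\varepsilon_{mn}\,P\Big(x_0+\sum_{k=1}^n\varepsilon_kx_1+\cdots+\sum_{k=1}^n\varepsilon_{(m-1)n+k}x_m\Big)^m,$$ where $P(y)^m:=P(y,\ldots,y)$ ($m$ times).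
   Context: $\mathcal{L}_a^s(^{N}E;F)$ denotes the vector space of all symmetric $N$-linear mappings $E^N\to F$ (no continuity required). A map $Q:E\to F$ is an $n$-homogeneous polynomial if there is an $n$-linear mapping $A:E^n\to F$ with $Q(x)=A(x,\ldots,x)$ for every $x\in E$. $\mathcal{P}_a^s(^{n,\overset{m}{\ldots},n}E;F)$ is the vector space of all mappings $P:E^m\to F$ such that (i) for each $1\le j\le m$ and all fixed $x_i\in E$ ($i\neq j$) the mapping $P(x_1,\ldots,x_{j-1},\cdot,x_{j+1},\ldots,x_m):E\to F$ is an $n$-homogeneous polynomial, and (ii) $P(x_{\sigma(1)},\ldots,x_{\sigma(m)})=P(x_1,\ldots,x_m)$ for all $x_1,\ldots,x_m\in E$ and all permutations $\sigma$ of $\{1,\ldots,m\}$. *)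

(* Defs.v *)
From HB Require Import structures.
From mathcomp Require Import all_boot all_order all_algebra all_fingroup.
From mathcomp Require Import complex mxtens.
From mathcomp Require Import boolp classical_sets functions reals.
From mathcomp Require Import topology normedtype.
Import Order.TTheory GRing.Theory Num.Theory.
Import numFieldNormedType.Exports.

Set Implicit Arguments.
Unset Strict Implicit.
Unset Printing Implicit Defensive.

Local Set Warnings "-redundant-canonical-projection".
Local Open Scope ring_scope.

Variant scalar_kind := real_scalars | complex_scalars.

Definition scalar_field (R : realType) (k : scalar_kind) : numFieldType :=
  match k with
  | real_scalars => R
  | complex_scalars => R[i]
  end.

Section Predicates.
Variables (K : numFieldType) (E F : lmodType K).

Definition multilinear (N : nat) (A : ('I_N -> E) -> F) : Prop :=
  forall (j : 'I_N) (x : 'I_N -> E), linear (fun y : E => A [eta x with j |-> y]).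

Definition symmetric_map (N : nat) (A : ('I_N -> E) -> F) : Prop :=
  forall (s : {perm 'I_N}) (x : 'I_N -> E), A (fun i => x (s i)) = A x.

Definition homogeneous_polynomial (n : nat) (Q : E -> F) : Prop :=
  exists2 A : ('I_n -> E) -> F, multilinear A & forall x, Q x = A (fun=> x).

Definition separately_homogeneous (m n : nat) (P : ('I_m -> E) -> F) : Prop :=
  forall (j : 'I_m) (x : 'I_m -> E),
    homogeneous_polynomial n (fun y : E => P [eta x with j |-> y]).

Definition symmetric_multilinear_pred (N : nat) : {pred ('I_N -> E) -> F} :=
  fun A => `[< multilinear A /\ symmetric_map A >].

Definition symmetric_multipolynomial_pred (m n : nat) :
    {pred ('I_m -> E) -> F} :=
  fun P => `[< separately_homogeneous n P /\ symmetric_map P >].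

End Predicates.

Section SymmetricMultilinear.
Variables (K : numFieldType) (N : nat) (E F : lmodType K).

Record symmetric_multilinear := SymmetricMultilinear {
  symmetric_multilinear_val :> ('I_N -> E) -> F;
  _ : symmetric_multilinear_val \in @symmetric_multilinear_pred K E F N }.

HB.instance Definition _ := [isSub for symmetric_multilinear_val].
HB.instance Definition _ := [Choice of symmetric_multilinear by <:].

Lemma symmetric_multilinear_submod :
  submod_closed (@symmetric_multilinear_pred K E F N).
Proof.
split=> [|a A B /asboolP[Am As] /asboolP[Bm Bs]]; apply/asboolP; split.
- by move=> j x c y z /=; rewrite scaler0 addr0.
- by [].
- move=> j x c y z.
  change (a *: A [eta x with j |-> c *: y + z] + B [eta x with j |-> c *: y + z] =
    c *: (a *: A [eta x with j |-> y] + B [eta x with j |-> y])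
    + (a *: A [eta x with j |-> z] + B [eta x with j |-> z])).
  rewrite Am Bm !scalerDr !scalerA [a * c]mulrC -!addrA; congr (_ + _).
  by rewrite addrCA.
- move=> s x.
  change (a *: A (fun i => x (s i)) + B (fun i => x (s i)) = a *: A x + B x).
  by rewrite As Bs.
Qed.

HB.instance Definition _ := GRing.isSubmodClosed.Build K (('I_N -> E) -> F)
  (@symmetric_multilinear_pred K E F N) symmetric_multilinear_submod.
HB.instance Definition _ :=
  [SubChoice_isSubLmodule of symmetric_multilinear by <:].

End SymmetricMultilinear.

Section SymmetricMultipolynomial.
Variables (K : numFieldType) (m n : nat) (E F : lmodType K).

Record symmetric_multipolynomial := SymmetricMultipolynomial {
  symmetric_multipolynomial_val :> ('I_m -> E) -> F;
  _ : symmetric_multipolynomial_val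
        \in @symmetric_multipolynomial_pred K E F m n }.

HB.instance Definition _ := [isSub for symmetric_multipolynomial_val].
HB.instance Definition _ := [Choice of symmetric_multipolynomial by <:].

Lemma symmetric_multipolynomial_submod :
  submod_closed (@symmetric_multipolynomial_pred K E F m n).
Proof.
split=> [|a P Q /asboolP[Pm Ps] /asboolP[Qm Qs]]; apply/asboolP; split.
- move=> j x; exists (fun=> 0) => // i y c u v /=.
  by rewrite scaler0 addr0.
- by [].
- move=> j x; have [A Am PA] := Pm j x; have [B Bm QB] := Qm j x.
  exists (fun y => a *: A y + B y) => [i y c u v|y] /=.
    rewrite Am Bm !scalerDr !scalerA [a * c]mulrC -!addrA; congr (_ + _).
    by rewrite addrCA.
  by rewrite -PA -QB.
- move=> s x.
  change (a *: P (fun i => x (s i)) + Q (fun i => x (s i)) = a *: P x + Q x).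
  by rewrite Ps Qs.
Qed.

HB.instance Definition _ := GRing.isSubmodClosed.Build K (('I_m -> E) -> F)
  (@symmetric_multipolynomial_pred K E F m n) symmetric_multipolynomial_submod.
HB.instance Definition _ :=
  [SubChoice_isSubLmodule of symmetric_multipolynomial by <:].

End SymmetricMultipolynomial.

Arguments symmetric_multilinear {K} N E F.
Arguments symmetric_multipolynomial {K} m n E F.

Section Psi.
Variables (K : numFieldType) (m n : nat) (E F : lmodType K).

(* The bijection [mxtens_index] : (j, k) |-> j * n + k cuts the m * n arguments
   into m consecutive blocks of length n; [(mxtens_unindex i).1] = i %/ n is the
   block containing i. *)
Definition Psi_fun (A : ('I_(m * n) -> E) -> F) (x : 'I_m -> E) : F :=
  A (fun i => x (mxtens_unindex i).1).

Lemma Psi_fun_subproof (A : symmetric_multilinear (m * n) E F) :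
  Psi_fun A \in @symmetric_multipolynomial_pred K E F m n.
Proof.
case: A => A /= /asboolP[Am As]; apply/asboolP; split.
- move=> j x.
  pose ext (y : 'I_n -> E) (i : 'I_(m * n)) : E :=
    if (mxtens_unindex i).1 == j then y (mxtens_unindex i).2
    else x (mxtens_unindex i).1.
  exists (fun y => A (ext y)) => // k y.
  have extE u : ext [eta y with k |-> u] =
      [eta (ext y) with mxtens_index (j, k) |-> u].
    apply/funext => i; case: (mxtens_indexP i) => i1 i2.
    transitivity (if mxtens_index (i1, i2) == mxtens_index (j, k) then u
                  else ext y (mxtens_index (i1, i2))); last by [].
    rewrite (can_eq (@mxtens_indexK m n)) xpair_eqE /ext mxtens_indexK /=.
    by case: (i1 == j).
  by move=> c u v; rewrite !extE; exact: Am.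
- move=> s x; rewrite /Psi_fun.
  pose f (i : 'I_(m * n)) : 'I_(m * n) :=
    mxtens_index (s (mxtens_unindex i).1, (mxtens_unindex i).2).
  have f_inj : injective f.
    move=> i i'; rewrite /f.
    case: (mxtens_indexP i) => i1 i2; case: (mxtens_indexP i') => i1' i2'.
    rewrite !mxtens_indexK => /(can_inj (@mxtens_indexK m n)).
    by case=> /perm_inj -> ->.
  rewrite -[RHS](As (perm f_inj)); congr A; apply/funext => i.
  by rewrite permE mxtens_indexK.
Qed.

Definition Psi (A : symmetric_multilinear (m * n) E F) :
    symmetric_multipolynomial m n E F :=
  SymmetricMultipolynomial (Psi_fun_subproof A).

End Psi.

Arguments Psi {K m n E F} A.

(* Main.v *)
(** Expanding [A(x0 + sum_i e_i y_i, ...)] for a multilinear [A] and averaging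
    over the signs leaves only the terms in which each [y_i] occurs exactly
    once, so the signed sum is [2^N sum_s A(y_(s 1), ..., y_(s N))].  For
    symmetric [A] this shows that [A] is determined by its diagonal, which is
    also the diagonal of [Psi A]: hence injectivity, and (a) => (b).
    Conversely, polarizing a multipolynomial [P] separately in each of its [m]
    variables gives a (non-symmetric) [mn]-linear map [C] with [Psi C = P]; in
    particular [y |-> P(y, ..., y)] is the diagonal of [C].  The right-hand
    side of (b) is then [Psi] of the symmetrization of [C]. *)
Require Import Defs.
From mathcomp Require Import all_boot all_order all_algebra.
From mathcomp Require Import mxtens classical_sets functions reals normedtype.
From mathcomp Require Import all_fingroup boolp.
Import GRing.Theory.
Local Open Scope ring_scope.
Local Open Scope classical_set_scope.

Set Implicit Arguments.
Unset Strict Implicit.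
Unset Printing Implicit Defensive.

(* [t0] is a placeholder value for the coordinates outside the index set. *)
Lemma big_ffun_update (V : nmodType) (I T : finType) (t0 : T) (S : {pred I})
    (j : I) (G : {ffun I -> T} -> V) : j \notin S ->
  \sum_(f : {ffun I -> T} | [forall i, (i \in predU1 j S) || (f i == t0)]) G f =
  \sum_t \sum_(f : {ffun I -> T} | [forall i, (i \in S) || (f i == t0)])
     G [ffun i => [eta f with j |-> t] i].
Proof.
(* Group the functions by their value [t] at [j]. Resetting that value to [t0] maps each group
   bijectively onto the functions equal to [t0] off [S]; [jS] makes the way back well defined. *)
move=> jS; rewrite (partition_big (fun f : {ffun I -> T} => f j) predT) //=.
apply: eq_bigr => t _.
rewrite (reindex_onto (fun f : {ffun I -> T} => [ffun i => [eta f with j |-> t] i])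
  (fun f => [ffun i => [eta f with j |-> t0] i])) /=; last first.
  move=> f /andP[_ /eqP fj]; apply/ffunP => i; rewrite !ffunE /= ?ffunE /=.
  by case: eqVneq => // ->.
apply: eq_bigl => f; rewrite !ffunE /= eqxx eqxx andbT.
apply/andP/forallP => [[/forallP fS /eqP fE] i|fS].
  have [->|ij] := eqVneq i j; first by rewrite -fE !ffunE /= eqxx eqxx orbT.
  by have := fS i; rewrite !inE (negPf ij) ffunE /= (negPf ij).
split; first apply/forallP => i.
  have [->|ij] := eqVneq i j; first by rewrite !inE eqxx.
  by rewrite !inE (negPf ij) ffunE /= (negPf ij); apply: fS.
apply/eqP/ffunP => i; rewrite !ffunE /= ?ffunE /=; case: eqVneq => // ->.
by have := fS j; rewrite (negPf jS) => /eqP.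
Qed.

Lemma linear_combination (K : numFieldType) (E F : lmodType K) (h : E -> F)
    (T : finType) (c : T -> K) (z : T -> E) : linear h ->
  h (\sum_t c t *: z t) = \sum_t c t *: h (z t).
Proof.
move=> hL; have h0 : h 0 = 0.
  by have := hL (-1) 0 0; rewrite scaler0 addr0 scaleN1r addNr.
by elim/big_rec2: _ => // t u v _ <-; rewrite hL.
Qed.

(** * Expansion and polarization of multilinear maps *)

Section Multilinear.
Variables (K : numFieldType) (E F : lmodType K) (N : nat).
Implicit Types (A : ('I_N -> E) -> F).

(** Induction on a duplicate-free list of coordinates, expanding one slot at a time. Choice
    functions are pinned to [t0] off the list, so that the full list gives all of them. *)
Lemma multilinear_sum A (T : finType) (t0 : T) (c : 'I_N -> T -> K)
    (z : 'I_N -> T -> E) : multilinear A ->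
  A (fun k => \sum_t c k t *: z k t) =
  \sum_(f : {ffun 'I_N -> T}) (\prod_k c k (f k)) *: A (fun k => z k (f k)).
Proof.
move=> Am.
have expand (s : seq 'I_N) (w : 'I_N -> E) : uniq s ->
    A (fun k => if k \in s then \sum_t c k t *: z k t else w k) =
    \sum_(f : {ffun 'I_N -> T} | [forall i, (i \in s) || (f i == t0)])
      (\prod_(k <- s) c k (f k)) *:
        A (fun k => if k \in s then z k (f k) else w k).
  elim: s w => [|j s IHs] w /=.
    move=> _; rewrite (big_pred1 [ffun=> t0]) ?big_nil ?scale1r // => f /=.
    apply/forallP/eqP => [ft|-> i]; last by rewrite ffunE eqxx.
    by apply/ffunP => i; rewrite ffunE; apply/eqP/ft.
  case/andP=> js us.
  transitivity (A [eta (fun k => if k \in s then \sum_t c k t *: z k t else w k)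
      with j |-> \sum_t c j t *: z j t]).
    by congr A; apply/funext => k /=; rewrite inE; case: eqVneq => // ->.
  rewrite (linear_combination _ _ (Am j _)).
  transitivity (\sum_(f : {ffun 'I_N -> T} |
      [forall i, (i \in predU1 j (mem s)) || (f i == t0)])
      (\prod_(k <- j :: s) c k (f k)) *:
        A (fun k => if k \in j :: s then z k (f k) else w k)); last first.
    by apply: eq_bigl => f; apply: eq_forallb => i; rewrite !inE.
  rewrite (big_ffun_update _ _ (S := mem s)) //; apply: eq_bigr => t _.
  transitivity (c j t *: A (fun k => if k \in s then \sum_t c k t *: z k t
      else [eta w with j |-> z j t] k)).
    congr (_ *: A _); apply/funext => k /=.
    by case: eqVneq => // ->; rewrite (negPf js).
  rewrite IHs // scaler_sumr; apply: eq_bigr => f _.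
  rewrite scalerA big_cons ffunE /= eqxx; congr (_ * _ *: A _).
    apply: eq_big_seq => k ks; rewrite ffunE /=.
    by case: eqVneq => // kj; rewrite -kj ks in js.
  apply/funext => k; rewrite ffunE /= inE.
  by case: eqVneq => //= ->; rewrite (negPf js).
have := expand (enum 'I_N) (fun=> 0) (enum_uniq _).
have -> : (fun k => if k \in enum 'I_N then \sum_t c k t *: z k t else 0) =
    (fun k => \sum_t c k t *: z k t).
  by apply/funext => k; rewrite mem_enum.
move=> ->; apply: eq_big => f.
  by apply/forallP => i; rewrite mem_enum.
rewrite big_enum /= => _; congr (_ *: A _); apply/funext => k.
by rewrite mem_enum.
Qed.

(** The weight [a] is left general to cover both multilinear maps ([a = id]) and separately
    homogeneous ones ([a t = t ^+ n]). *)
Lemma separately_scalable (G : ('I_N -> E) -> F) (a : K -> K) (c : 'I_N -> K)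
    (x : 'I_N -> E) :
  (forall j y t u, G [eta y with j |-> t *: u] = a t *: G [eta y with j |-> u]) ->
  G (fun k => c k *: x k) = (\prod_k a (c k)) *: G x.
Proof.
move=> Ga.
have scale (s : seq 'I_N) : uniq s ->
    G (fun k => if k \in s then c k *: x k else x k) =
    (\prod_(k <- s) a (c k)) *: G x.
  elim: s => [|j s IHs] /=; first by rewrite big_nil scale1r.
  case/andP=> js us; rewrite big_cons -scalerA -IHs //.
  transitivity (G [eta (fun k => if k \in s then c k *: x k else x k)
      with j |-> c j *: x j]).
    by congr G; apply/funext => k /=; rewrite inE; case: eqVneq => // ->.
  rewrite Ga; congr (_ *: G _); apply/funext => k /=.
  by case: eqVneq => // ->; rewrite (negPf js).
have := scale _ (enum_uniq 'I_N); rewrite big_enum => <-.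
by congr G; apply/funext => k; rewrite mem_enum.
Qed.

(** A section [g] of [f] over the values [Some i] is injective, hence a permutation of ['I_N], and
    [f] is then its inverse followed by [Some]. *)
Lemma codom_Some_perm (f : {ffun 'I_N -> option 'I_N}) :
  [forall i, Some i \in codom f] ->
  exists s : {perm 'I_N}, f = [ffun i => Some (s i)].
Proof.
move=> /forallP surj; pose g i := iinv (surj i).
have fg i : f (g i) = Some i := f_iinv (surj i).
have g_inj : injective g by move=> i j gij; apply: Some_inj; rewrite -!fg gij.
exists (perm g_inj)^-1%g; apply/ffunP => k; rewrite ffunE -fg.
by rewrite -{1}[k](permKV (perm g_inj)) permE.
Qed.

(* [None] stands for the base point [x0], which carries no sign. *)
Lemma sum_sign_prod (f : {ffun 'I_N -> option 'I_N}) :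
  \sum_(e : {ffun 'I_N -> bool}) (\prod_i (-1) ^+ e i) *
     \prod_k oapp (fun i => (-1) ^+ e i) 1 (f k) =
  (if [forall i, Some i \in codom f] then 2 ^+ N else 0 : K).
Proof.
(* Collect powers sign by sign: that of [i] occurs once in the outer product and once for each [k]
   with [f k = Some i]. The sum over [e] then factors over [i]. *)
transitivity (\sum_(e : {ffun 'I_N -> bool})
    \prod_i (-1 : K) ^+ (e i * (1 + \sum_k (f k == Some i)))).
  apply: eq_bigr => e _.
  have -> : \prod_k oapp (fun i => (-1) ^+ e i) 1 (f k) =
      \prod_k \prod_i (-1 : K) ^+ (e i * (f k == Some i)).
    apply: eq_bigr => k _; case: (f k) => [i|] /=.
      rewrite (bigD1 i) //= eqxx muln1 big1 ?mulr1 // => i' ii'.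
      rewrite [Some _ == _](_ : _ = false) ?muln0 //.
      by apply/eqP => -[E']; rewrite E' eqxx in ii'.
    by rewrite big1 // => i _; rewrite muln0.
  rewrite exchange_big -big_split /=; apply: eq_bigr => i _.
  by rewrite mulnDr muln1 exprD big_distrr -expr_sum.
rewrite -(bigA_distr_bigA
  (fun i (b : bool) => (-1 : K) ^+ (b * (1 + \sum_k (f k == Some i))))) /=.
case: ifPn => [/codom_Some_perm[s ->]|].
  have f1 i : (\sum_k ([ffun k => Some (s k)] k == Some i) = 1)%N.
    rewrite (bigD1 (s^-1%g i)) //= ffunE permKV eqxx big1 // => k ki.
    rewrite ffunE; case: eqP => // -[ski].
    by rewrite -ski permK eqxx in ki.
  transitivity (\prod_(i < N) (2 : K)); last by rewrite prodr_const card_ord.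
  by apply: eq_bigr => i _; rewrite big_bool f1 /= mul1n mul0n sqrrN expr1n expr0.
(* A missed index [i] leaves exponent 1, so its factor is -1 + 1 = 0. *)
rewrite negb_forall => /existsP[i fi].
have fi0 : (\sum_k (f k == Some i) = 0)%N.
  by rewrite big1 // => k _; case: eqP => // fk; rewrite -fk codom_f in fi.
rewrite (bigD1 i) //= big_bool /= fi0 mul1n mul0n addn0 expr1 expr0.
by rewrite [X in X * _]addNr mul0r.
Qed.

Lemma polarization A (x0 : E) (y : 'I_N -> E) : multilinear A ->
  \sum_(e : {ffun 'I_N -> bool}) (\prod_i (-1) ^+ e i) *:
    A (fun=> x0 + \sum_i (-1) ^+ e i *: y i) =
  2 ^+ N *: \sum_(s : {perm 'I_N}) A (fun i => y (s i)).
Proof.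
move=> Am.
(* View each argument as a combination indexed by [option 'I_N], with [x0] at [None] with
   coefficient 1, and expand. *)
transitivity (\sum_(f : {ffun 'I_N -> option 'I_N})
   (\sum_(e : {ffun 'I_N -> bool}) (\prod_i (-1) ^+ e i) *
     \prod_k oapp (fun i => (-1) ^+ e i) 1 (f k)) *: A (fun k => oapp y x0 (f k))).
  under [RHS]eq_bigr do rewrite scaler_suml.
  rewrite exchange_big; apply: eq_bigr => e _ /=.
  under [RHS]eq_bigr do rewrite -scalerA.
  rewrite -scaler_sumr; congr (_ *: _).
  rewrite -(multilinear_sum None (fun _ => oapp (fun i => (-1) ^+ e i) 1)
    (fun _ => oapp y x0)) //; congr A; apply/funext => _.
  rewrite (bigD1 None) //= scale1r (reindex_omap Some id) => [|[]] //=.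
  by congr (_ + _); apply: eq_bigl => i; rewrite eqxx.
under eq_bigr do rewrite sum_sign_prod.
rewrite (bigID (fun f : {ffun 'I_N -> option 'I_N} =>
  [forall i, Some i \in codom f])) /=.
rewrite [X in _ + X]big1 ?addr0; last by move=> f /negPf ->; rewrite scale0r.
(* A permutation is an injective finite function packed as a subtype, so [insub] inverts the
   embedding [s |-> Some (s i)] once [Some] is stripped. *)
have insubE (s : {perm 'I_N}) :
    insub [ffun i => odflt i ([ffun i => Some (s i)] i)] = Some s.
  rewrite [X in insub X](_ : _ = val s) ?valK //.
  by apply/ffunP => i; rewrite !ffunE pvalE.
rewrite (reindex_omap (fun s : {perm 'I_N} => [ffun i => Some (s i)])
  (fun f => insub [ffun i => odflt i (f i)])) /=; last first.
  by move=> f /codom_Some_perm[s ->]; rewrite insubE.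
rewrite scaler_sumr; apply: eq_big => s.
  rewrite insubE eqxx andbT; apply/forallP => i.
  by apply/codomP; exists (s^-1%g i); rewrite ffunE permKV.
move=> /andP[-> _]; congr (_ *: A _).
by apply/funext => i; rewrite ffunE.
Qed.

Lemma symmetric_polarization A (x0 : E) (y : 'I_N -> E) :
    multilinear A -> symmetric_map A ->
  A y = ((N`!)%:R * 2 ^+ N)^-1 *:
    \sum_(e : {ffun 'I_N -> bool}) (\prod_i (-1) ^+ e i) *:
      A (fun=> x0 + \sum_i (-1) ^+ e i *: y i).
Proof.
move=> Am As; rewrite polarization // (eq_bigr (fun=> A y)) // sumr_const.
rewrite card_Sn -scaler_nat !scalerA [2 ^+ N * _]mulrC mulVf ?scale1r //.
by rewrite mulf_neq0 // ?expf_neq0 ?Num.Theory.pnatr_eq0 // -lt0n fact_gt0.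
Qed.

End Multilinear.

(** * Symmetrization, and the polarization constant *)

Section Symmetrization.
Variables (K : numFieldType) (E F : lmodType K).

Lemma eq_linear (f g : E -> F) : f =1 g -> linear f -> linear g.
Proof. by move=> fg fL c u v; rewrite -!fg fL. Qed.

Lemma linear_weighted_sum (I : finType) (Q : pred I) (a : I -> K)
    (h : I -> E -> F) : (forall i, linear (h i)) ->
  linear (fun u => \sum_(i | Q i) a i *: h i u).
Proof.
move=> hL c u v; rewrite scaler_sumr -big_split /=; apply: eq_bigr => i _.
by rewrite hL scalerDr !scalerA [c * _]mulrC.
Qed.

Lemma multilinear_perm (N : nat) (A : ('I_N -> E) -> F) (s : {perm 'I_N}) :
  multilinear A -> multilinear (fun y => A (fun i => y (s i))).
Proof.
move=> Am j y; apply: eq_linear (Am (s^-1%g j) (fun i => y (s i))) => u.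
congr A; apply/funext => i /=.
by rewrite (canF_eq (permK s)).
Qed.

(** The weight sits inside the sum so that [linear_weighted_sum] applies directly. *)
Definition symmetrization (N : nat) (A : ('I_N -> E) -> F) (y : 'I_N -> E) : F :=
  \sum_(s : {perm 'I_N}) (N`!)%:R^-1 *: A (fun i => y (s i)).

Lemma symmetrization_multilinear (N : nat) (A : ('I_N -> E) -> F) :
  multilinear A -> multilinear (symmetrization A).
Proof.
move=> Am j y; apply: linear_weighted_sum => s; exact: (multilinear_perm s Am).
Qed.

Lemma symmetrization_symmetric (N : nat) (A : ('I_N -> E) -> F) :
  symmetric_map (symmetrization A).
Proof.
move=> t y; rewrite [RHS](reindex_inj (mulIg t)) /=; apply: eq_bigr => s _.
by congr (_ *: A _); apply/funext => i; rewrite permM.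
Qed.

End Symmetrization.

(** This is [polarization] of the product of [n] scalars, at base point 0 with every vector equal to
    1. It supplies the normalizing constant of one block. *)
Lemma sum_sign_power (K : numFieldType) (n : nat) :
  \sum_(d : {ffun 'I_n -> bool}) (\prod_l (-1) ^+ d l) *
    (\sum_l (-1) ^+ d l) ^+ n = (n`!)%:R * 2 ^+ n :> K.
Proof.
have prod_multi : multilinear (fun z : 'I_n -> K^o => \prod_k z k : K^o).
  move=> j x c u v; rewrite !(bigD1 j (P := predT)) //= eqxx.
  have prodE w : \prod_(k | k != j) [eta x with j |-> w] k = \prod_(k | k != j) x k.
    by apply: eq_bigr => k /= /negPf ->.
  by rewrite !prodE /= mulrDl -scalerAl.
have := polarization 0 (fun=> 1) prod_multi.
under [X in _ = _ *: X]eq_bigr do rewrite big1 //.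
rewrite sumr_const card_Sn -[X in _ *: X]/((n`!)%:R : K) [X in _ = X]mulrC => <-.
apply: eq_bigr => d _; rewrite prodr_const card_ord add0r; congr (_ * _ ^+ _).
by apply: eq_bigr => l _; rewrite [RHS]mulr1.
Qed.

(** * Polarization of a multipolynomial in each variable *)

Section BlockPolarization.
Variables (K : numFieldType) (E F : lmodType K) (m n : nat).
Variables (P : ('I_m -> E) -> F) (P_homog : separately_homogeneous n P).

Lemma separately_homogeneous_scale (c : 'I_m -> K) (x : 'I_m -> E) :
  P (fun j => c j *: x j) = (\prod_j c j ^+ n) *: P x.
Proof.
apply: (separately_scalable (a := fun t => t ^+ n)) => j y t u.
have [A Am PA] := P_homog j y; rewrite !PA.
rewrite (separately_scalable (a := id)) ?prodr_const ?card_ord //.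
move=> i z r v; have := linear_combination (fun _ : 'I_1 => r) (fun=> v) (Am i z).
by rewrite !big_ord1.
Qed.

(** Here [e j] holds the [n] signs of block [j], and each of the [m] blocks contributes one
    normalizing factor. *)
Definition block_polarization (y : 'I_(m * n) -> E) : F :=
  \sum_(e : {ffun 'I_m -> {ffun 'I_n -> bool}})
    (((n`!)%:R * 2 ^+ n)^-1 ^+ m * \prod_j \prod_l (-1) ^+ e j l) *:
    P (fun j => \sum_l (-1) ^+ e j l *: y (mxtens_index (j, l))).

(** With the other signs fixed, the sum over the signs of block [j0] polarizes an [n]-linear map
    representing [P] in its variable [j0], so it is a sum of permuted copies of that map. *)
Lemma block_polarization_multilinear : multilinear block_polarization.
Proof.
move=> i y; case: (mxtens_indexP i) => j0 l0.
pose x (f : {ffun 'I_m -> {ffun 'I_n -> bool}}) j :=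
  \sum_l (-1) ^+ f j l *: y (mxtens_index (j, l)).
pose z (u : E) := [eta (fun l => y (mxtens_index (j0, l))) with l0 |-> u].
pose h f u := \sum_(d : {ffun 'I_n -> bool}) (\prod_l (-1) ^+ d l) *:
  P [eta x f with j0 |-> \sum_l (-1) ^+ d l *: z u l].
have hL f : linear (h f).
  have [A Am PA] := P_homog j0 (x f).
  have -> : h f = fun u => \sum_(s : {perm 'I_n}) 2 ^+ n *:
      A (fun l => [eta (fun l => y (mxtens_index (j0, l))) with l0 |-> u] (s l)).
    apply/funext => u; rewrite -scaler_sumr -(polarization 0) //.
    by apply: eq_bigr => d _; rewrite add0r PA.
  by apply: linear_weighted_sum => s; apply: multilinear_perm.
(* The outer sum runs over the signs of the other blocks; the entry at [j0] is held at the
   placeholder [[ffun=> false]]. *)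
apply: eq_linear (linear_weighted_sum
  [pred f : {ffun 'I_m -> {ffun 'I_n -> bool}} |
    [forall j, (j \in predC1 j0) || (f j == [ffun=> false])]]
  (fun f => ((n`!)%:R * 2 ^+ n)^-1 ^+ m *
    \prod_(j | j != j0) \prod_l (-1) ^+ f j l) hL) => u.
rewrite /block_polarization.
transitivity (\sum_(f : {ffun 'I_m -> {ffun 'I_n -> bool}} |
    [forall j, (j \in predU1 j0 (predC1 j0)) || (f j == [ffun=> false])])
    (((n`!)%:R * 2 ^+ n)^-1 ^+ m * \prod_j \prod_l (-1) ^+ f j l) *:
    P (fun j => \sum_l (-1) ^+ f j l *:
      [eta y with mxtens_index (j0, l0) |-> u] (mxtens_index (j, l)))); last first.
  by apply: eq_bigl => f; apply/forallP => j; rewrite !inE; case: (j == j0).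
(* Polarization in block [j0], with the signs of all other blocks frozen. *)
rewrite big_ffun_update ?inE ?eqxx // exchange_big /=; apply: eq_bigr => f _.
rewrite scaler_sumr; apply: eq_bigr => d _; rewrite scalerA -mulrA.
congr (_ * _ *: P _).
  rewrite [RHS](bigD1 j0) //= ffunE eqxx mulrC; congr (_ * _).
  by apply: eq_bigr => j /negPf jj0; rewrite ffunE /= jj0.
apply/funext => j; rewrite ffunE /=; case: eqVneq => [->|jj0].
  apply: eq_bigr => l _; rewrite (can_eq (@mxtens_indexK m n)).
  by rewrite xpair_eqE eqxx.
apply: eq_bigr => l _; rewrite (can_eq (@mxtens_indexK m n)).
by rewrite xpair_eqE (negPf jj0).
Qed.

(** On block-constant arguments each block gives a sum of signs times [x j]. Homogeneity extracts
    its [n]-th power, and the sum over [e] becomes a product of [m] copies of [sum_sign_power]. *)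
Lemma Psi_block_polarization : Psi_fun block_polarization = P.
Proof.
apply/funext => x; rewrite /Psi_fun /block_polarization.
under eq_bigr => e _.
  rewrite [X in P X](_ : _ = fun j => (\sum_l (-1) ^+ e j l) *: x j); last first.
    apply/funext => j; rewrite scaler_suml; apply: eq_bigr => l _.
    by rewrite mxtens_indexK.
  rewrite separately_homogeneous_scale scalerA -mulrA -big_split /=.
  over.
rewrite -scaler_suml -mulr_sumr.
rewrite -(bigA_distr_bigA (fun _ (d : {ffun 'I_n -> bool}) =>
  (\prod_l (-1) ^+ d l) * (\sum_l (-1) ^+ d l) ^+ n)) /=.
under eq_bigr do rewrite sum_sign_power.
rewrite prodr_const card_ord -exprMn mulVf ?expr1n ?scale1r //.
by rewrite mulf_neq0 // ?expf_neq0 ?Num.Theory.pnatr_eq0 // -lt0n fact_gt0.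
Qed.

End BlockPolarization.

(** * Injectivity and characterization of the range *)

(** Passes from the argument produced by [polarization] on a block-constant family to the one in
    condition (b). *)
Lemma sum_block_signs (K : numFieldType) (E : lmodType K) (m n : nat)
    (c : 'I_(m * n) -> K) (x : 'I_m -> E) :
  \sum_i c i *: x (mxtens_unindex i).1 =
  \sum_(j < m) (\sum_(l < n) c (mxtens_index (j, l))) *: x j.
Proof.
under [RHS]eq_bigr do rewrite scaler_suml.
rewrite pair_big (reindex (@mxtens_index m n)); last first.
  by exists (@mxtens_unindex m n) => i _; rewrite ?mxtens_indexK ?mxtens_unindexK.
by apply: eq_bigr => -[j l] _; rewrite mxtens_indexK.
Qed.

Lemma eq_Psi_fun_diag (K : numFieldType) (E F : lmodType K) (m n : nat)
    (A B : ('I_(m * n) -> E) -> F) (z : E) :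
  Psi_fun A = Psi_fun B -> A (fun=> z) = B (fun=> z).
Proof. by move=> /(congr1 (fun P => P (fun=> z))). Qed.

Lemma symmetric_multilinear_Psi_eq (K : numFieldType) (E F : lmodType K)
    (m n : nat) (A B : symmetric_multilinear (m * n) E F) :
  Psi_fun A = Psi_fun B -> A = B.
Proof.
move=> AB; apply/val_inj/funext => y /=.
have /asboolP[Am As] := valP A; have /asboolP[Bm Bs] := valP B.
rewrite (symmetric_polarization 0 y Am As) (symmetric_polarization 0 y Bm Bs).
by congr (_ *: _); apply: eq_bigr => e _; congr (_ *: _); exact: eq_Psi_fun_diag AB.
Qed.

Lemma Psi_linear (K : numFieldType) (E F : lmodType K) (m n : nat) :
  linear (@Psi K m n E F).
Proof. by move=> c A B; apply/val_inj/funext. Qed.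

Theorem proposition3p4 (R : realType) (k : scalar_kind)
    (E F : completeNormedModType (scalar_field R k)) (m n : nat)
    (m_gt0 : (0 < m)%N) (n_gt0 : (0 < n)%N) :
  let Psi_mn := @Psi (scalar_field R k) m n E F in
  [/\ linear Psi_mn,
      set_bij [set: symmetric_multilinear (m * n) E F] (range Psi_mn) Psi_mn
    & forall P : symmetric_multipolynomial m n E F,
        range Psi_mn P <->
        forall (x0 : E) (x : 'I_m -> E),
          P x = (((m * n)`!)%:R * 2 ^+ (m * n))^-1 *:
            \sum_(e : {ffun 'I_(m * n) -> bool})
              (\prod_(i < m * n) (-1) ^+ e i) *:
              P (fun=> x0 + \sum_(j < m)
                   (\sum_(l < n) (-1) ^+ e (mxtens_index (j, l))) *: x j)].
Proof.
move=> Psi_mn; split; first exact: Psi_linear.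
  split=> [A _|A B _ _ /(congr1 val)|P [A _ <-]]; first by exists A.
    exact: symmetric_multilinear_Psi_eq.
  by exists A.
move=> P; have /asboolP[Ph _] := valP P; split.
  case=> A _ <- x0 x; have /asboolP[Am As] := valP A.
  rewrite [LHS](symmetric_polarization x0 _ Am As).
  congr (_ *: _); apply: eq_bigr => e _.
  by rewrite -(sum_block_signs (fun i => (-1) ^+ e i)).
move=> Pb; pose C : ('I_(m * n) -> E) -> F := block_polarization P.
have Cm : multilinear C by exact: block_polarization_multilinear.
have Bsub : symmetrization C \in @symmetric_multilinear_pred _ E F (m * n).
  apply/asboolP; split; first exact: symmetrization_multilinear.
  exact: symmetrization_symmetric.
exists (SymmetricMultilinear Bsub) => //; apply: val_inj; apply/funext => x.
transitivity (symmetrization C (fun i => x (mxtens_unindex i).1)) => //.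
(* Use (b) at base point 0 and rewrite the diagonal of [P] as that of [C]. Polarizing [C] yields a
   factor [2 ^+ (m * n)] that cancels, leaving the average over permutations. *)
apply: etrans (esym (Pb 0 x)); rewrite /symmetrization -scaler_sumr.
under [in RHS]eq_bigr => e _ do
  rewrite -(Psi_block_polarization Ph) -(sum_block_signs (fun i => (-1) ^+ e i)).
rewrite [X in _ = _ *: X](polarization _ _ Cm).
rewrite scalerA invfM -mulrA mulVf ?mulr1 //.
by rewrite expf_neq0 // Num.Theory.pnatr_eq0.
Qed.
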